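(* Let $A$ be a finite alphabet and let $u,w\in A^*$. Then $$\langle A^*\sqcup\!\sqcup_q u,\,w\rangle=\binom{w}{u}_q ,$$ where $A^*$ on the left-hand side is understood as the formal series all of whose coefficients are equal to $1$.
   Context: $A^*$ is the free monoid of finite words over $A$ (with concatenation and empty word $\varepsilon$), and $|w|$ is the length of a word $w$. The $q$-binomial coefficient $\binom{u}{v}_q\in\mathbb{N}[q]$ of two words $u,v\in A^*$ is defined recursively by $\binom{u}{\varepsilon}_q=1$, $\binom{\varepsilon}{v}_q=0$ if $v\neq\varepsilon$, and, for all $u,v\in A^*$ and letters $a,b\in A$, $\binom{ua}{vb}_q=q^{|vb|}\binom{u}{vb}_q+\delta_{a,b}\binom{u}{v}_q$, where $\delta_{a,b}$ is the Kronecker delta. $\mathbb{N}[q]\langle\langle A^*\rangle\rangle$ is the set of formal series, i.e. maps $A^*\to\mathbb{N}[q]$; $\langle s,w\rangle$ is the coefficient of the word $w$ in $s$; $\mathbb{N}[q]\langle A^*\rangle$ is the set of series with finite support. For $s\in\mathbb{N}[q]\langle A^*\rangle$ and a letter $a$, $sa$ is obtained by appending $a$ to each word of $s$. The $q$-shuffle $u\sqcup\!\sqcup_q v\in\mathbb{N}[q]\langle A^*\rangle$ of two words is defined recursively by $u\sqcup\!\sqcup_q\varepsilon=\varepsilon\sqcup\!\sqcup_q u=u$ and, for $u,v\in A^*$, $a,b\in A$, $ua\sqcup\!\sqcup_q vb=q^{|vb|}(u\sqcup\!\sqcup_q vb)a+(ua\sqcup\!\sqcup_q v)b$. For a series $s$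 and a word $u$, $s\sqcup\!\sqcup_q u=\sum_{v\in A^*}\langle s,v\rangle\,(v\sqcup\!\sqcup_q u)$; in particular $A^*\sqcup\!\sqcup_q u=\sum_{v\in A^*}v\sqcup\!\sqcup_q u$. *)

(* Defs.v *)
From mathcomp Require Import all_boot all_order all_algebra.
From mathcomp Require Import classical_sets functions cardinality fsbigop.

Set Implicit Arguments.
Unset Strict Implicit.
Unset Printing Implicit Defensive.

Import GRing.Theory.
Local Open Scope classical_set_scope.
Local Open Scope ring_scope.

(* Words over A are sequences [seq A], read from left to right, and N[q] is
   [{poly nat}] with q = ['X].  The recursions below peel off the last letter of
   a word; they are implemented by structural recursion on reversed words, and
   the defining equations on words themselves are the lemmas following them. *)

Section Words.
Variable A : finType.
Implicit Types (u v w : seq A) (a b : A).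

Fixpoint qbinom_rev (ru rv : seq A) : {poly nat} :=
  match rv, ru with
  | [::], _ => 1
  | _ :: _, [::] => 0
  | b :: rv', a :: ru' =>
      'X^(size rv) * qbinom_rev ru' rv + (a == b)%:R * qbinom_rev ru' rv'
  end.

Definition qbinom u v : {poly nat} := qbinom_rev (rev u) (rev v).

Lemma qbinom_nilr u : qbinom u [::] = 1.
Proof. by rewrite /qbinom; case: (rev u). Qed.

Lemma qbinom_nill v : v != [::] -> qbinom [::] v = 0.
Proof. by case/lastP: v => // v b _; rewrite /qbinom rev_rcons. Qed.

Lemma qbinom_rcons u v a b :
  qbinom (rcons u a) (rcons v b) =
  'X^(size (rcons v b)) * qbinom u (rcons v b) + (a == b)%:R * qbinom u v.
Proof. by rewrite /qbinom !rev_rcons /= size_rev size_rcons. Qed.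

(* The coefficient of the word w in the series s is [s w]. *)
Definition series := seq A -> {poly nat}.

Definition word_series u : series := fun w => (w == u)%:R.

Definition all_words : series := fun=> 1.

Definition append_letter (s : series) a : series := fun w =>
  if rev w is b :: rw then (b == a)%:R * s (rev rw) else 0.

Lemma append_letter_nil s a : append_letter s a [::] = 0.
Proof. by []. Qed.

Lemma append_letter_rcons s a w b :
  append_letter s a (rcons w b) = (b == a)%:R * s w.
Proof. by rewrite /append_letter rev_rcons revK. Qed.

Lemma append_letter_word u a :
  append_letter (word_series u) a =1 word_series (rcons u a).
Proof.
case/lastP=> [|w b]; first by rewrite append_letter_nil /word_series; case: u.
rewrite append_letter_rcons /word_series eqseq_rcons andbC.
by case: (b == a); rewrite ?mul1r ?mul0r.
Qed.

Fixpoint qshuffle_rev (ru : seq A) : seq A -> series :=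
  fix qshuffle_rev_ru (rv : seq A) : series :=
    match ru, rv with
    | _, [::] => word_series (rev ru)
    | [::], _ => word_series (rev rv)
    | a :: ru', b :: rv' => fun w =>
        'X^(size rv) * append_letter (qshuffle_rev ru' rv) a w
        + append_letter (qshuffle_rev_ru rv') b w
    end.

Definition qshuffle u v : series := qshuffle_rev (rev u) (rev v).

Lemma qshuffle_nilr u : qshuffle u [::] = word_series u.
Proof. by rewrite -[u in RHS]revK /qshuffle; case: (rev u). Qed.

Lemma qshuffle_nill u : qshuffle [::] u = word_series u.
Proof. by rewrite -[u in RHS]revK /qshuffle; case: (rev u). Qed.

Lemma qshuffle_rcons u v a b w :
  qshuffle (rcons u a) (rcons v b) w =
  'X^(size (rcons v b)) * append_letter (qshuffle u (rcons v b)) a w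
  + append_letter (qshuffle (rcons u a) v) b w.
Proof. by rewrite /qshuffle !rev_rcons /= size_rev size_rcons. Qed.

Lemma qshuffle_size u v w :
  qshuffle u v w != 0 -> size w = (size u + size v)%N.
Proof.
have word_size x y : word_series x y != 0 -> size y = size x.
  by rewrite /word_series; case: (y =P x) => [->|]; rewrite ?eqxx.
elim/last_ind: u v w => [|u a IHu] v w.
  by rewrite qshuffle_nill => /word_size.
elim/last_ind: v w => [|v b IHv] w.
  by rewrite qshuffle_nilr addn0 => /word_size.
rewrite qshuffle_rcons; case/lastP: w => [|w c].
  by rewrite !append_letter_nil mulr0 addr0 eqxx.
rewrite !append_letter_rcons !size_rcons.
have [->|nu] := eqVneq (qshuffle u (rcons v b) w) 0; last first.
  by rewrite (IHu _ _ nu) size_rcons addSn.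
have [->|nv] := eqVneq (qshuffle (rcons u a) v w) 0; last first.
  by rewrite (IHv _ nv) size_rcons addnS.
by rewrite !mulr0 addr0 eqxx.
Qed.

Lemma finite_words n : finite_set [set v : seq A | size v = n].
Proof.
have -> : [set v : seq A | size v = n] =
    (fun t : n.-tuple A => tval t) @` setT.
  apply/seteqP; split=> [v /= /eqP sv | _ [t _ <-] /=].
    by exists (Tuple sv).
  exact: size_tuple.
exact/finite_image/finite_finset.
Qed.

Lemma qshuffle_finite_support u v :
  finite_set [set w | qshuffle u v w != 0].
Proof.
apply: sub_finite_set (finite_words (size u + size v)).
by move=> w /= /qshuffle_size.
Qed.

(* The sum ranges over all words; [\sum_(v \in setT)] is the sum over the support
   of the summand, which is finite by [qshuffle_series_finite_support]. *)
Definition qshuffle_series (s : series) u : series := fun w =>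
  \sum_(v \in [set: seq A]) s v * qshuffle v u w.

Lemma qshuffle_series_finite_support (s : series) u w :
  finite_set [set v | s v * qshuffle v u w != 0].
Proof.
apply: sub_finite_set (finite_words (size w - size u)).
move=> v /= nz; have /qshuffle_size -> : qshuffle v u w != 0.
  by apply: contraNneq nz => ->; rewrite mulr0.
by rewrite addnK.
Qed.

End Words.

Arguments all_words : clear implicits.

(* Main.v *)
(* Split the sum over words v according to whether v is empty or ends with a
   letter: the q-shuffle recursion for nonempty v turns into the q-binomial
   recursion, up to the missing word u in the sum of the products with u, which
   the empty v supplies since its product with ub is ub. *)

Require Import Defs.
From mathcomp Require Import all_boot all_order all_algebra.
From mathcomp Require Import classical_sets fsbigop.

Set Implicit Arguments.
Unset Strict Implicit.
Unset Printing Implicit Defensive.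

Import GRing.Theory.
Local Open Scope ring_scope.

Section BoundedWords.
Variable A : finType.
Implicit Types (u v w : seq A) (a b : A).

(** Words grow at their last letter, matching the recursions of [qbinom] and [qshuffle]. *)
Fixpoint words_upto n : seq (seq A) :=
  if n is n'.+1 then
    [::] :: [seq rcons v a | v <- words_upto n', a <- enum A]
  else [:: [::]].

Lemma mem_words_upto n v : (v \in words_upto n) = (size v <= n)%N.
Proof.
elim: n v => [|n IHn] v /=; first by rewrite inE; case: v.
rewrite inE; case/lastP: v => [|v a]; first by rewrite eqxx.
rewrite size_rcons ltnS -size_eq0 size_rcons /= -IHn.
apply/allpairsP/idP => [[[v' a'] /= [v'n _ /rcons_inj[-> _]]] // | vn].
by exists (v, a); rewrite mem_enum.
Qed.

Lemma words_upto_uniq n : uniq (words_upto n).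
Proof.
elim: n => //= n IHn; apply/andP; split.
  by apply/allpairsP => -[[[|? ?] ?] [_ _]].
apply: allpairs_uniq; rewrite ?enum_uniq // => -[v a] [v' a'] _ _ /=.
by move=> /rcons_inj[-> ->].
Qed.

Lemma big_words_uptoS (R : nmodType) n (F : seq A -> R) :
  \sum_(v <- words_upto n.+1) F v =
  F [::] + \sum_(v <- words_upto n) \sum_a F (rcons v a).
Proof.
rewrite big_cons big_allpairs_dep; congr (_ + _).
by apply: eq_bigr => v _; rewrite big_enum.
Qed.

Lemma qshuffle_nil u v :
  qshuffle u v [::] = ((u == [::]) && (v == [::]))%:R.
Proof.
case/lastP: u => [|u a]; first by rewrite qshuffle_nill /word_series eq_sym.
case/lastP: v => [|v b].
  by rewrite qshuffle_nilr /word_series eq_sym andbT.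
by rewrite qshuffle_rcons !append_letter_nil mulr0 addr0 -size_eq0 size_rcons.
Qed.

Lemma sum_kronecker (R : pzSemiRingType) c (F : A -> R) :
  \sum_a (c == a)%:R * F a = F c.
Proof.
rewrite (bigD1 c) //= eqxx mul1r big1 ?addr0 // => a ac.
by rewrite eq_sym (negbTE ac) mul0r.
Qed.

(** Truncation loses nothing: a word longer than [w] has no shuffle containing [w]. The bound [n]
    stays free because the induction needs two different values of it. *)
Lemma qshuffle_words_upto n u w : (size w <= n)%N ->
  \sum_(v <- words_upto n) qshuffle v u w = qbinom w u.
Proof.
elim/last_ind: u w n => [|u b IHu] w n wn.
  rewrite qbinom_nilr (bigD1_seq w) ?mem_words_upto ?words_upto_uniq //=.
  rewrite qshuffle_nilr /word_series eqxx big1 ?addr0 // => v vw.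
  by rewrite qshuffle_nilr /word_series eq_sym (negbTE vw).
have nu : rcons u b != [::] by rewrite -size_eq0 size_rcons.
elim/last_ind: w n wn => [|w c IHw] n wn.
  rewrite qbinom_nill // big1 // => v _.
  by rewrite qshuffle_nil (negbTE nu) andbF.
case: n wn => [|n]; rewrite size_rcons // ltnS => wn.
(* Stripping the last letter of the summation word lowers its length bound to [n]; stripping [b]
   from [rcons u b] leaves that word intact, so the bound stays [n.+1]. *)
rewrite qbinom_rcons -(IHw n) // -(IHu w n.+1) ?leqW // !big_words_uptoS.
rewrite !qshuffle_nill /word_series eqseq_rcons.
(* In the first term of the shuffle recursion the final letter [c] forces [a = c], collapsing the
   sum over [a]; in the second, [a] stays free and the factor for [c == b] comes out. *)
under eq_bigr => v _.
  under eq_bigr => a _ do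
    rewrite qshuffle_rcons !append_letter_rcons mulrCA.
  rewrite big_split /= sum_kronecker -big_distrr /=.
  over.
(* After cancellation only the empty word's contributions remain to be compared. *)
rewrite big_split /= -!big_distrr /= mulrDr addrCA.
by rewrite -natrM mulnb andbC.
Qed.

End BoundedWords.

Theorem proposition5p7 (A : finType) (u w : seq A) :
  qshuffle_series (all_words A) u w = qbinom w u.
Proof.
rewrite /qshuffle_series -(@qshuffle_words_upto A (size w)) //.
under eq_fsbigr do rewrite /all_words mul1r.
(* By [qshuffle_size], a nonzero coefficient at [w] forces [size v <= size w], so the support lies
   in this list. *)
rewrite -(fsbig_widen [set` words_upto A (size w)]) // => [|v [_ /= nv]].
  by rewrite -fsbig_seq // words_upto_uniq.
have [//|/qshuffle_size sw] := eqVneq (qshuffle v u w) 0.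
by case: nv; rewrite mem_words_upto sw leq_addr.
Qed.
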